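(* Let $C_{(>,\leq)}(x,y)$ be the bivariate generating function of the Catalan words avoiding the ordered pair of relations $(>,\leq)$, where $x$ marks the length and $y$ marks the number of descents. Then $$C_{(>,\leq)}(x,y)=\frac{1 - x - x^2 y}{1 - 2 x - x^2 y}.$$
   Context: A Catalan word of length $n$ is a word $w=w_1w_2\cdots w_n$ over the non-negative integers with $w_1=0$ and $0\leq w_i\leq w_{i-1}+1$ for $i=2,\dots,n$; the empty word is the unique Catalan word of length $0$. For relations $X,Y\in\{<,>,\leq,\geq,=,\neq\}$, a word $w$ contains the pattern $(X,Y)$ if there is an index $i\geq 1$ (with $i+2\le n$) such that $w_i\,X\,w_{i+1}$ and $w_{i+1}\,Y\,w_{i+2}$; otherwise $w$ avoids $(X,Y)$. The number of descents $\mathrm{des}(w)$ is the number of indices $i$ with $w_i>w_{i+1}$. The bivariate generating function is $C_{(X,Y)}(x,y)=\sum_{w}x^{|w|}y^{\mathrm{des}(w)}$, the sum being over all Catalan words $w$ (of any length $|w|\geq 0$) avoiding $(X,Y)$. Identities are between formal power series in $x$ with coefficients polynomials in $y$. *)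

(* Defs.v *)
From HB Require Import structures.
From mathcomp Require Import all_boot all_order all_algebra.
From mathcomp Require Import boolp classical_sets functions cardinality fsbigop.

Set Implicit Arguments.
Unset Strict Implicit.
Unset Printing Implicit Defensive.

Import GRing.Theory.
Local Open Scope ring_scope.

Record fps (R : Type) : Type := FPS { fps_coef : nat -> R }.

Notation "{ 'fps' R }" := (fps R) (at level 0, format "{ 'fps'  R }").

Lemma fpsP (R : Type) (f g : {fps R}) : fps_coef f =1 fps_coef g -> f = g.
Proof. by case: f g => f [g] /= /funext ->. Qed.

(* Equality of series is not decidable: these instances come from the
   classical axioms of boolp. *)
HB.instance Definition _ (R : Type) := gen_eqMixin {fps R}.
HB.instance Definition _ (R : Type) := gen_choiceMixin {fps R}.

Section Zmodule.
Variable R : zmodType.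
Implicit Types f g h : {fps R}.

Definition fps_zero : {fps R} := FPS (fun=> 0).
Definition fps_opp f : {fps R} := FPS (fun n => - fps_coef f n).
Definition fps_add f g : {fps R} := FPS (fun n => fps_coef f n + fps_coef g n).

Fact fps_addA : associative fps_add.
Proof. by move=> f g h; apply: fpsP => n; apply: addrA. Qed.
Fact fps_addC : commutative fps_add.
Proof. by move=> f g; apply: fpsP => n; apply: addrC. Qed.
Fact fps_add0 : left_id fps_zero fps_add.
Proof. by move=> f; apply: fpsP => n; apply: add0r. Qed.
Fact fps_addN : left_inverse fps_zero fps_opp fps_add.
Proof. by move=> f; apply: fpsP => n; apply: addNr. Qed.

HB.instance Definition _ :=
  GRing.isZmodule.Build {fps R} fps_addA fps_addC fps_add0 fps_addN.

End Zmodule.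

Section ComRing.
Variable R : comNzRingType.
Implicit Types f g h : {fps R}.

Definition fpsC (c : R) : {fps R} := FPS (fun n => if n == 0%N then c else 0).
Definition fpsX : {fps R} := FPS (fun n => (n == 1%N)%:R).
Definition fps_mul f g : {fps R} :=
  FPS (fun n => \sum_(i < n.+1) fps_coef f i * fps_coef g (n - i)).

Definition fps_trunc N f : {poly R} := \poly_(i < N) fps_coef f i.

Lemma coef_fps_mul N f g n : (n < N)%N ->
  fps_coef (fps_mul f g) n = (fps_trunc N f * fps_trunc N g)`_n.
Proof.
move=> ltnN; rewrite coefM; apply: eq_bigr => i _.
have lein : (i <= n)%N by rewrite -ltnS.
by rewrite !coef_poly (leq_ltn_trans lein ltnN) (leq_ltn_trans (leq_subr _ _)).
Qed.

Fact fps_mulA : associative fps_mul.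
Proof.
move=> f g h; apply: fpsP => n.
have coefE (p q : {poly R}) (u v : {fps R}) :
    (forall i, (i <= n)%N -> fps_coef u i = p`_i) ->
    (forall i, (i <= n)%N -> fps_coef v i = q`_i) ->
  fps_coef (fps_mul u v) n = (p * q)`_n.
  move=> up vq; rewrite coefM; apply: eq_bigr => i _.
  by rewrite up -1?ltnS // vq // leq_subr.
have truncE u i : (i <= n)%N -> fps_coef u i = (fps_trunc n.+1 u)`_i.
  by move=> lein; rewrite coef_poly ltnS lein.
rewrite (coefE (fps_trunc n.+1 f) (fps_trunc n.+1 g * fps_trunc n.+1 h)).
- rewrite (coefE (fps_trunc n.+1 f * fps_trunc n.+1 g) (fps_trunc n.+1 h)).
  + by rewrite mulrA.
  + by move=> i lein; apply: coef_fps_mul; rewrite ltnS.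
  + exact: truncE.
- exact: truncE.
- by move=> i lein; apply: coef_fps_mul; rewrite ltnS.
Qed.

Fact fps_mulC : commutative fps_mul.
Proof.
by move=> f g; apply: fpsP => n; rewrite !(coef_fps_mul _ _ (ltnSn n)) mulrC.
Qed.

Fact fps_mul1 : left_id (fpsC 1) fps_mul.
Proof.
move=> f; apply: fpsP => n /=; rewrite big_ord_recl /= mul1r subn0.
by rewrite big1 ?addr0 // => i _; rewrite mul0r.
Qed.

Fact fps_mulDl : left_distributive fps_mul (@fps_add R).
Proof.
move=> f g h; apply: fpsP => n /=; rewrite -big_split /=.
by apply: eq_bigr => i _; rewrite mulrDl.
Qed.

Fact fps_oner_neq0 : fpsC 1 != 0.
Proof.
apply/eqP => /(congr1 (fun f : {fps R} => fps_coef f 0)) /= /eqP.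
by rewrite oner_eq0.
Qed.

HB.instance Definition _ := GRing.Zmodule_isComNzRing.Build {fps R}
  fps_mulA fps_mulC fps_mul1 fps_mulDl fps_oner_neq0.

End ComRing.

Arguments fpsX {R}.

Section UnitRing.
Variable R : comUnitRingType.
Implicit Types f g : {fps R}.

Definition fps_unit : {pred {fps R}} :=
  [pred f | fps_coef f 0 \is a GRing.unit].

(* The first n coefficients g_0, ..., g_(n-1) of the inverse g of f, obtained
   by solving f_0 * g_m + \sum_(i < m) f_(m-i) * g_i = (m == 0) for g_m. *)
Fixpoint fps_inv_coefs f (n : nat) : seq R :=
  if n is m.+1 then
    let s := fps_inv_coefs f m in
    rcons s ((fps_coef f 0)^-1 *
             ((m == 0%N)%:R - \sum_(i < m) fps_coef f (m - i) * s`_i))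
  else [::].

(* As for every unitRingType, the inverse of a non-unit is itself. *)
Definition fps_inv f : {fps R} :=
  if f \in fps_unit then FPS (fun n => (fps_inv_coefs f n.+1)`_n) else f.

Lemma size_fps_inv_coefs f n : size (fps_inv_coefs f n) = n.
Proof. by elim: n => //= n IHn; rewrite size_rcons IHn. Qed.

Lemma nth_fps_inv_coefs f m n : (m < n)%N ->
  (fps_inv_coefs f n)`_m = (fps_inv_coefs f m.+1)`_m.
Proof.
elim: n => // n IHn; rewrite ltnS leq_eqVlt => /predU1P[-> //|ltmn].
by rewrite -IHn // [in LHS]/= nth_rcons size_fps_inv_coefs ltmn.
Qed.

Fact fps_mulVx : {in fps_unit, left_inverse 1 fps_inv *%R}.
Proof.
move=> f f_unit; rewrite mulrC /fps_inv f_unit; apply: fpsP => n.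
rewrite [LHS]/= big_ord_recl subn0 [(fps_inv_coefs f n.+1)`_n]/=.
rewrite nth_rcons size_fps_inv_coefs ltnn eqxx mulVKr //.
suff -> : \sum_(i < n) fps_coef f (lift ord0 i) *
            (fps_inv_coefs f (n - lift ord0 i).+1)`_(n - lift ord0 i) =
          \sum_(i < n) fps_coef f (n - i) * (fps_inv_coefs f n)`_i.
  by rewrite subrK; case: n.
rewrite (reindex_inj rev_ord_inj) /=; apply: eq_bigr => i _.
rewrite /bump /= add1n -subSn // subSS subKn 1?ltnW //.
by rewrite [RHS](congr1 _ (nth_fps_inv_coefs f (ltn_ord i))).
Qed.

Fact fps_unitPl f g : g * f = 1 -> fps_unit f.
Proof.
move=> /(congr1 (fun h : {fps R} => fps_coef h 0)) /=.
rewrite big_ord1 /= => gf1; apply/unitrPr; exists (fps_coef g 0).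
by rewrite mulrC.
Qed.

Fact fps_invr_out : {in [predC fps_unit], fps_inv =1 id}.
Proof. by move=> f; rewrite inE /= /fps_inv => /negPf ->. Qed.

HB.instance Definition _ := GRing.ComNzRing_hasMulInverse.Build {fps R}
  fps_mulVx fps_unitPl fps_invr_out.

End UnitRing.

(* Words are sequences of naturals; the letter w_i of the usual 1-based
   notation is [nth 0 w (i - 1)]. *)
Definition catalan_word (w : seq nat) : Prop :=
  ((0 < size w)%N -> nth 0%N w 0 = 0%N) /\
  (forall i, (i.+1 < size w)%N -> (nth 0 w i.+1 <= (nth 0 w i).+1)%N).

Definition contains_pattern (X Y : rel nat) (w : seq nat) : Prop :=
  exists i, [/\ (i.+2 < size w)%N,
    X (nth 0%N w i) (nth 0%N w i.+1) & Y (nth 0%N w i.+1) (nth 0%N w i.+2)].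

Definition avoids_pattern (X Y : rel nat) (w : seq nat) : Prop :=
  ~ contains_pattern X Y w.

Definition des (w : seq nat) : nat :=
  #|[set i : 'I_(size w).-1 | (nth 0 w i > nth 0 w i.+1)%N]|.

Definition catalan_avoiding (X Y : rel nat) (n : nat) : set (seq nat) :=
  [set w | [/\ size w = n, catalan_word w & avoids_pattern X Y w]]%classic.

(* Hence the sum over this set in catalan_gf is a genuine finite sum, not the
   default value 0 that \sum_(w \in A) takes on infinite supports. *)
Lemma finite_catalan_avoiding X Y n : finite_set (catalan_avoiding X Y n).
Proof.
pose words := [seq map val (val t) | t : n.-tuple 'I_n].
apply: (@sub_finite_set _ _ [set` words]%classic); last first.
  exact: finite_seq.
move=> w /= [sz_w [w0 wS] _].
have w_bound i : (i < size w)%N -> (nth 0 w i <= i)%N.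
  elim: i => [/w0 -> // | i IHi lti].
  by apply: leq_trans (wS i lti) _; rewrite ltnS IHi // ltnW.
have w_lt : all (fun a => a < n)%N w.
  apply/(all_nthP 0%N) => i lti.
  by rewrite (leq_ltn_trans (w_bound i lti)) // -sz_w.
have map_w : map val (pmap (insub : nat -> option 'I_n) w) = w.
  rewrite (pmap_filter (insubK _)); apply/all_filterP.
  by apply: sub_all w_lt => a /=; rewrite isSome_insub.
have sz_t : size (pmap (insub : nat -> option 'I_n) w) == n.
  by rewrite -(size_map val) map_w sz_w.
by apply/mapP; exists (Tuple sz_t); rewrite ?mem_enum.
Qed.

(* The length is marked by the variable of the series, and the number of
   descents by the variable 'X of the polynomial coefficients. *)
Definition catalan_gf (X Y : rel nat) : {fps {poly int}} :=
  FPS (fun n => \sum_(w \in catalan_avoiding X Y n) ('X^(des w) : {poly int})).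

(* Main.v *)
(** The first letter below its predecessor must be followed by a strictly
decreasing sequence, so a nonempty word is [0 :: t] where the tail [t] is either
empty, or [0 :: u], or [1 :: u'] with [u'] the tail [u] raised by one, or
[1 :: rcons u' 0]: after a [1], a letter [0] is preceded by a descent and is therefore
final. Tails of length [n + 2] are thus counted by
[b_(n+2) = 2 b_(n+1) + y b_n], and the series is [1 + x / (1 - 2 x - x^2 y)]. *)

Require Import Defs.
From mathcomp Require Import all_boot all_order all_algebra.
From mathcomp Require Import classical_sets fsbigop.
From mathcomp Require Import ring.

Import GRing.Theory.
Local Open Scope ring_scope.

(** * Coefficients of products with [fpsX] and with constants *)

Section PowerSeries.
Variable R : comNzRingType.
Implicit Types f g : {fps R}.

Lemma fps_coefD f g n : fps_coef (f + g) n = fps_coef f n + fps_coef g n.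
Proof. by []. Qed.

Lemma fps_coefN f n : fps_coef (- f) n = - fps_coef f n.
Proof. by []. Qed.

Lemma fps_coef1 n : fps_coef (1 : {fps R}) n = (n == 0%N)%:R.
Proof. by rewrite /=; case: eqP. Qed.

Lemma fps_coefXM f n : fps_coef (fpsX * f) n = if n is m.+1 then fps_coef f m else 0.
Proof.
rewrite [LHS]/=; case: n => [|n]; first by rewrite big_ord1 mul0r.
rewrite big_ord_recl mul0r add0r big_ord_recl mul1r subSS subn0.
by rewrite big1 ?addr0 // => i _; rewrite mul0r.
Qed.

Lemma fps_coefCM c f n : fps_coef (fpsC c * f) n = c * fps_coef f n.
Proof.
rewrite [LHS]/= big_ord_recl subn0.
by rewrite big1 ?addr0 // => i _; rewrite mul0r.
Qed.

End PowerSeries.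

(** * Avoidance and descents, read letter by letter *)

Local Open Scope nat_scope.

(** Here [a] is the letter before [s]. Once a descent occurs, every later step must be a descent, as
    [path gtn] tests; the bound on growth is then automatic. *)
Fixpoint rise_fall (a : nat) (s : seq nat) : bool :=
  if s is b :: s' then
    if b < a then path gtn b s' else (b <= a.+1) && rise_fall b s'
  else true.

Fixpoint descents (a : nat) (s : seq nat) : nat :=
  if s is b :: s' then (b < a) + descents b s' else 0.

Lemma des_cons a s : des (a :: s) = descents a s.
Proof.
have desE w : des w = \sum_(i < (size w).-1) (nth 0 w i.+1 < nth 0 w i).
  rewrite /des -sum1_card big_mkcond /=; apply: eq_bigr => i _.
  by rewrite inE; case: (_ < _).
elim: s a => [|b s IHs] a; first by rewrite desE big_ord0.
rewrite desE big_ord_recl /= -IHs desE /=.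
by congr (_ + _); apply: eq_bigr => i _.
Qed.

(** The condition that the first letter is [0] is dropped, so that the property passes to suffixes
    and allows induction. *)
Definition local_avoiding (w : seq nat) : Prop :=
  (forall i, i.+1 < size w -> nth 0 w i.+1 <= (nth 0 w i).+1) /\
  avoids_pattern (fun a b => a > b) (fun a b => a <= b) w.

Definition head_below (b : nat) (s : seq nat) : bool :=
  if s is c :: _ then c < b else true.

Lemma local_avoiding_cons2 a b s :
  local_avoiding [:: a, b & s] <->
  [/\ b <= a.+1, local_avoiding (b :: s) & b < a -> head_below b s].
Proof.
split=> [[wS w_av]|[leba [wS w_av] ba]]; split.
- exact: (wS 0).
- split=> [i|[i ih]]; first exact: (wS i.+1).
  by apply: w_av; exists i.+1.
- case: s wS w_av => // c s _ w_av ltba; rewrite /head_below ltnNge; apply/negP => lebc.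
  by apply: w_av; exists 0.
- by case=> // i; apply: wS.
(* Only an occurrence at index [0] involves [a], and [ba] excludes it. *)
- case=> -[|i] ih; last by apply: w_av; exists i.
  case: s ba ih {wS w_av} => [|c s] ba [] //= _ /ba/= ltcb.
  by rewrite leqNgt ltcb.
Qed.

(** Each descent forces the next one, so the fall begun by [head_below] goes on to the end. *)
Lemma local_avoiding_falling b s :
  local_avoiding (b :: s) /\ head_below b s <-> path gtn b s.
Proof.
elim: s b => [|c s IHs] b.
  by split=> // _; split=> //; split=> // -[[|i] []].
rewrite local_avoiding_cons2 /=; split.
  by case=> -[_ c_s s_c] ltcb; rewrite ltcb; apply/IHs; split=> //; apply: s_c.
case/andP=> ltcb /IHs [c_s s_c]; split=> //; split=> //.
by rewrite ltnW // ltnW.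
Qed.

Lemma local_avoidingE a s : local_avoiding (a :: s) <-> rise_fall a s.
Proof.
elim: s a => [|b s IHs] a.
  by split=> // _; split=> // -[[|i] []].
rewrite local_avoiding_cons2 /=; case: ltnP => [ltba|leab].
  rewrite -local_avoiding_falling; split=> [[_ b_s /(_ isT)]|[b_s s_b]] //.
  by split=> //; rewrite ltnW // ltnW.
split=> [[-> /IHs]|/andP[-> /IHs]] //.
Qed.

Lemma catalan_avoidingE n w :
  catalan_avoiding (fun a b => a > b) (fun a b => a <= b) n.+1 w <->
  exists2 t, size t = n /\ rise_fall 0 t & w = 0 :: t.
Proof.
split=> [[sz_w [w0 wS] w_av]|[t [<- t_rf] ->]].
  case: w sz_w w0 wS w_av => // a t [sz_t] /= /(_ isT) -> wS w_av.
  by exists t => //; split=> //; apply/local_avoidingE; split.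
by have /local_avoidingE[wS w_av] := t_rf; split=> //; split.
Qed.

(** * Words raised by one, possibly followed by a [0] *)

Section Shift.
Implicit Types (a b : nat) (s u : seq nat).

Lemma path_gtn_shift b u : path gtn b.+1 (map S u) = path gtn b u.
Proof. by elim: u b => //= c u IHu b; rewrite IHu. Qed.

Lemma path_gtn_shift_rcons b u : path gtn b.+1 (rcons (map S u) 0) = path gtn b u.
Proof. by elim: u b => //= c u IHu b; rewrite IHu. Qed.

Lemma rise_fall_shift a u : rise_fall a.+1 (map S u) = rise_fall a u.
Proof. by elim: u a => //= b u IHu a; rewrite IHu path_gtn_shift. Qed.

Lemma rise_fall_shift_rcons a u :
  rise_fall a.+1 (rcons (map S u) 0) = rise_fall a u.
Proof. by elim: u a => //= b u IHu a; rewrite IHu path_gtn_shift_rcons. Qed.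

(** In a strictly decreasing word only the last letter can be [0]. *)
Lemma path_gtn_unshift b s : path gtn b.+1 s ->
  exists u, s = map S u \/ s = rcons (map S u) 0.
Proof.
elim: s b => [|c s IHs] b /=; first by exists [::]; left.
case: c => [|c] /andP[_ s_c].
  by exists [::]; right; case: s s_c {IHs} => // d s /andP[].
by have [u [->|->]] := IHs _ s_c; exists (c :: u); [left|right].
Qed.

(** The first [0] follows a positive letter, so it makes a descent; nothing being smaller than [0],
    the word stops there. *)
Lemma rise_fall_unshift a s : rise_fall a.+1 s ->
  exists2 u, rise_fall a u & s = map S u \/ s = rcons (map S u) 0.
Proof.
(* Only the shape of [s] has to be found: the shift equalities then carry [s_rf] over to [u]. *)
move=> s_rf; suff [u us]: exists u, s = map S u \/ s = rcons (map S u) 0.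
  exists u => //; move: s_rf.
  by case: us => ->; rewrite (rise_fall_shift, rise_fall_shift_rcons).
elim: s a s_rf => [|[|b] s IHs] a /=; first by exists [::]; left.
  by case: s {IHs} => [|d s /andP[]] //; exists [::]; right.
have tailP : (exists u, s = map S u \/ s = rcons (map S u) 0) ->
    exists u, b.+1 :: s = map S u \/ b.+1 :: s = rcons (map S u) 0.
  by case=> u [->|->]; exists (b :: u); [left|right].
by case: ifP => _ => [/path_gtn_unshift|/andP[_ /IHs]] /tailP.
Qed.

Lemma descents_shift a u : descents a.+1 (map S u) = descents a u.
Proof. by elim: u a => //= b u IHu a; rewrite IHu. Qed.

Lemma descents_shift_rcons a u :
  descents a.+1 (rcons (map S u) 0) = (descents a u).+1.
Proof. by elim: u a => //= b u IHu a; rewrite IHu addnS. Qed.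

End Shift.

(** * Enumeration of the tails by length *)

Fixpoint tails (n : nat) : seq (seq nat) :=
  if n is m.+1 then
    [seq 0 :: u | u <- tails m] ++ [seq 1 :: map S u | u <- tails m] ++
    (if m is k.+1 then [seq 1 :: rcons (map S u) 0 | u <- tails k] else [::])
  else [:: [::]].

Lemma tailsS n : tails n.+1 =
  [seq 0 :: u | u <- tails n] ++ [seq 1 :: map S u | u <- tails n] ++
  (if n is k.+1 then [seq 1 :: rcons (map S u) 0 | u <- tails k] else [::]).
Proof. by []. Qed.

Lemma mem_tails n t : (t \in tails n) = (size t == n) && rise_fall 0 t.
Proof.
elim/ltn_ind: n t => -[|n] IHn t; first by rewrite inE; case: t.
rewrite tailsS !mem_cat; apply/or3P/andP.
  case.
  - by case/mapP=> u; rewrite IHn // => /andP[/eqP <- ?] ->.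
  - case/mapP=> u; rewrite IHn // => /andP[/eqP <- ?] ->.
    by rewrite /= size_map rise_fall_shift.
  - case: n IHn => // n IHn /mapP[u]; rewrite IHn // => /andP[/eqP <- ?] ->.
    by rewrite /= size_rcons size_map rise_fall_shift_rcons.
(* After the initial [0] the first letter of a tail is [0] or [1]. *)
case: t => [[]|[|[|b]] s [/eqP[sz_s] /= s_rf]] //.
  by apply: Or31; apply: map_f; rewrite IHn // sz_s eqxx.
have [u u_rf [def_s|def_s]] := rise_fall_unshift _ _ s_rf.
  apply: Or32; rewrite def_s; apply/mapP; exists u => //.
  by rewrite IHn // u_rf -sz_s def_s size_map eqxx.
apply: Or33; move: sz_s; rewrite def_s size_rcons size_map => sz_u.
by rewrite -sz_u; apply: map_f; rewrite IHn -?sz_u // eqxx.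
Qed.

(** The first letter separates the first family from the other two; the final [0] separates the
    third from the second, whose letters are all positive. *)
Lemma uniq_tails n : uniq (tails n).
Proof.
have injS : injective (map S) by apply: inj_map => i j [].
elim/ltn_ind: n => -[|n] IHn //; rewrite tailsS !cat_uniq.
rewrite !map_inj_uniq ?IHn //=; try by [move=> u v [] | move=> u v [/injS]].
apply/and3P; split.
- apply/hasPn => t; rewrite mem_cat; case/orP.
    by case/mapP=> u _ -> /=; apply/mapP=> -[].
  by case: n {IHn} => // n /mapP[u _ ->] /=; apply/mapP=> -[].
- case: n {IHn} => // n; apply/hasPn => t /mapP[u _ ->].
  apply/mapP=> -[v _ [uv]].
  have : 0 \in map S v by rewrite -uv mem_rcons inE.
  by case/mapP.
- case: n IHn => // n IHn; rewrite map_inj_uniq ?IHn // => u v [/rcons_inj[]].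
  exact: injS.
Qed.

(** * Generating functions *)

Local Open Scope ring_scope.

Definition tail_gf : {fps {poly int}} :=
  FPS (fun n => \sum_(t <- tails n) 'X^(descents 0 t)).

(** The first two families keep the number of descents, whence the factor [2]; the final [0] of the
    third adds one, whence the factor ['X]. *)
Lemma tail_gfS n : fps_coef tail_gf n.+1 =
  2 * fps_coef tail_gf n + (if n is k.+1 then 'X * fps_coef tail_gf k else 0).
Proof.
rewrite [LHS]/= -/(tails n) !big_cat !big_map /= addrA mulr_natl mulr2n.
congr (_ + _ + _).
  by apply: eq_bigr => u _; rewrite descents_shift.
case: n => [|n]; first by rewrite big_nil.
rewrite big_map mulr_sumr; apply: eq_bigr => u _.
by rewrite /= descents_shift_rcons exprS.
Qed.

Lemma tail_gf_eq :
  tail_gf * (1 - 2 * fpsX - fpsX ^+ 2 * fpsC 'X) = 1.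
Proof.
(* With each [fpsX] as a left factor, [fps_coefXM] reads the products as index shifts. *)
have -> : tail_gf * (1 - 2 * fpsX - fpsX ^+ 2 * fpsC 'X) =
    tail_gf - (fpsX * tail_gf + fpsX * tail_gf) - fpsX * (fpsX * (fpsC 'X * tail_gf)).
  by ring.
apply: fpsP => n; rewrite !(fps_coefD, fps_coefN) fps_coef1 !fps_coefXM.
case: n => [|n]; first by rewrite /= big_seq1 expr0 !subr0 addr0 subr0.
rewrite tail_gfS fps_coefXM; case: n => [|n]; last rewrite fps_coefCM; rewrite [RHS]/=; ring.
Qed.

Lemma catalan_gf_tail :
  catalan_gf (fun a b => a > b)%N (fun a b => a <= b)%N = 1 + fpsX * tail_gf.
Proof.
apply: fpsP => n; rewrite fps_coefD fps_coef1 fps_coefXM.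
(* The sum over a set becomes a sum over any duplicate-free list of its elements. *)
have sumE (r : seq (seq nat)) : uniq r ->
    (forall w, catalan_avoiding (fun a b => a > b)%N (fun a b => a <= b)%N n w <-> w \in r) ->
    fps_coef (catalan_gf (fun a b => a > b)%N (fun a b => a <= b)%N) n =
    \sum_(w <- r) 'X^(des w).
  move=> r_uniq rP; rewrite fsbig_seq //=; congr (\sum_(w \in _) _).
  by apply/seteqP; split=> w /rP.
case: n sumE => [|n] sumE.
  (* The empty word has no leading [0] to remove; it gives the summand [1]. *)
  rewrite (sumE [:: [::]]) //.
    rewrite big_seq1 addr0 /des; set A := [set _ | _].
    by rewrite [A](_ : _ = finset.set0) ?cards0 //; apply/setP => -[].
  move=> w; rewrite inE; split=> [[/size0nil ->]|/eqP ->] //.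
  by split=> // -[i []].
rewrite (sumE [seq 0%N :: t | t <- tails n]).
- by rewrite big_map add0r; apply: eq_bigr => t _; rewrite des_cons.
- by rewrite map_inj_uniq ?uniq_tails // => u v [].
move=> w; rewrite catalan_avoidingE; split.
  by case=> t [sz_t t_rf] ->; apply: map_f; rewrite mem_tails sz_t eqxx.
by case/mapP=> t; rewrite mem_tails => /andP[/eqP ? ?] ->; exists t.
Qed.

Theorem theorem3p29 :
  let x : {fps {poly int}} := fpsX in
  let y : {fps {poly int}} := fpsC 'X in
  catalan_gf (fun a b => a > b)%N (fun a b => a <= b)%N =
    (1 - x - x ^+ 2 * y) / (1 - 2 * x - x ^+ 2 * y).
Proof.
move=> x y; have D := tail_gf_eq; rewrite -/x -/y in D.
have D_unit : 1 - 2 * x - x ^+ 2 * y \is a GRing.unit.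
  by apply/unitrPr; exists tail_gf; rewrite mulrC.
apply: (canRL (mulrK D_unit)).
(* By [D], multiplying [1 + x * tail_gf] by the denominator adds just [x] to it, which is the
   numerator. *)
by rewrite catalan_gf_tail -/x mulrDl mul1r -(mulrA x tail_gf) D; ring.
Qed.
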